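(* There exists a triangle-free graph $G$ such that $\tau_{K_4}(G)=3$. Consequently, $\rho(4)=3$.
   Context: All graphs are finite and simple. A matching is a set of pairwise vertex-disjoint edges; $V(M)$ denotes the set of endpoints of the edges of $M$. Degree-preserving Builder--Chooser game started from a graph $G_0$: it is played in rounds $t=1,2,\dots$. In round $t$ the current graph is $G_{t-1}=(V,E)$. (i) Builder chooses a matching $M\subseteq E$ and forms the intermediate graph $G^+$ by deleting the edges of $M$, adding a new vertex $w$, and joining $w$ to every vertex of $V(M)$ (a DPG step). (ii) Builder chooses a partition of $E(G^+)$ into two disjoint sets $E^{(0)}\sqcup E^{(1)}$. (iii) Chooser selects $i\in\{0,1\}$, and $G_t:=(V(G^+),E^{(i)})$. For graphs $H$ and $G_0$, the forcing time $\tau_H(G_0)$ is the least $T\ge 0$ such that Builder has a strategy in the game started from $G_0$ guaranteeing that $G_t$ contains $H$ as a (not necessarily induced) subgraph for some $0\le t\le T$; $\tau_H(G_0)=\infty$ if there is no such $T$, i.e. if Chooser can avoid $H$ forever. For $k\ge 3$, $\rho(k):=\min\{\tau_{K_k}(G): G \text{ is triangle-free and } \tau_{K_k}(G)<\infty\}$, with $\rho(k)=\infty$ if no triangle-free graph $G$ has $\tau_{K_k}(G)<\infty$. *)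

(* Defs.v *)
From mathcomp Require Import all_boot.
From mathcomp Require Import boolp.

Set Implicit Arguments.
Unset Strict Implicit.
Unset Printing Implicit Defensive.

(* An edge is the two-element set of its endpoints, so loops and multiple
   edges are impossible. *)
Record graph := Graph {
  vertex :> finType;
  edges : {set {set vertex}};
  edges_card2 : forall e, e \in edges -> #|e| = 2
}.

(* Not necessarily induced subgraph. *)
Definition contains (H G : graph) : Prop :=
  exists2 f : H -> G, injective f & forall e, e \in edges H -> f @: e \in edges G.

Lemma complete_card2 k (e : {set 'I_k}) :
  e \in [set e : {set 'I_k} | #|e| == 2] -> #|e| = 2.
Proof. by rewrite inE => /eqP. Qed.

Definition complete (k : nat) : graph := Graph (@complete_card2 k).

Definition triangle_free (G : graph) : Prop := ~ contains (complete 3) G.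

Definition is_matching (G : graph) (M : {set {set G}}) : bool :=
  (M \subset edges G) && trivIset M.

(* The new vertex w is None; V(M) is cover M. *)
Definition dpg_edges (G : graph) (M : {set {set G}}) : {set {set option G}} :=
  [set Some @: (e : {set G}) | e in edges G :\: M]
    :|: [set [set None; Some v] | v in cover M].

Lemma dpg_card2 (G : graph) (M : {set {set G}}) e :
  e \in dpg_edges M -> #|e| = 2.
Proof.
case/setUP=> /imsetP[x xP ->]; last by rewrite cards2.
rewrite card_imset; last by move=> ? ? [].
by case/setDP: xP => /edges_card2.
Qed.

Definition dpg (G : graph) (M : {set {set G}}) : graph := Graph (@dpg_card2 G M).

(* The classes E^(0) and E^(1) are part false and part true; either may be
   empty, and so may the matching. *)
Record move (G : graph) := Move {
  matching : {set {set G}};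
  part : bool -> {set {set dpg matching}};
  matchingP : is_matching matching;
  part_cover : part false :|: part true = edges (dpg matching);
  part_disjoint : [disjoint part false & part true]
}.

Lemma next_card2 (G : graph) (m : move G) (i : bool) e :
  e \in part m i -> #|e| = 2.
Proof.
move=> eP; apply: (@edges_card2 (dpg (matching m))).
by rewrite -part_cover inE; case: i eP => ->; rewrite ?orbT.
Qed.

Definition next_graph (G : graph) (m : move G) (i : bool) : graph :=
  Graph (@next_card2 G m i).

(* A Builder strategy is a move together with a strategy for the continuation
   after each answer of Chooser; it may thus depend on the whole history. *)
CoInductive strategy (G : graph) : Type :=
  Strategy (m : move G) of (forall i : bool, strategy (next_graph m i)).

(* The graph G_t when Builder follows s and Chooser selects c t in round
   t + 1. *)
Fixpoint play (G : graph) (s : strategy G) (c : nat -> bool) (t : nat) : graph :=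
  if t is t'.+1 then
    let: Strategy m s' := s in play (s' (c 0)) (fun j => c j.+1) t'
  else G.

(* Against a fixed Builder strategy, every behaviour of Chooser amounts to a
   sequence of selections. *)
Definition forces_within (H G : graph) (T : nat) : Prop :=
  exists s : strategy G, forall c : nat -> bool,
    exists2 t, t <= T & contains H (play s c t).

(* Minimum of a set of naturals, None standing for infinity (empty set). *)
Definition least (P : nat -> Prop) : option nat :=
  if pselect (exists n, `[< P n >]) is left exP then Some (ex_minn exP) else None.

Definition forcing_time (H G : graph) : option nat := least (forces_within H G).

Definition rho (k : nat) : option nat :=
  least (fun n => exists2 G : graph,
    triangle_free G & forcing_time (complete k) G = Some n).

(* Main.v *)
Require Import Defs.
From mathcomp Require Import all_boot.
From mathcomp Require Import boolp.

Set Implicit Arguments.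
Unset Strict Implicit.
Unset Printing Implicit Defensive.

(* Lower bound: let G be triangle-free and let w1, w2 be the first two new
   vertices.  Every triangle of G_1 contains w1 and G_1 has no K_4, so every
   K_4 available in round 2 contains the edge w1w2; hence one of the two
   classes has no K_4.

   Upper bound: Builder wins in one round from two disjoint triangles whose six
   vertices are covered by a matching avoiding the triangle edges, because the
   new vertex turns them into two edge-disjoint copies of K_4.  From the tree
   made of an edge ab, two leaves a', a'' at a and two leaves b', b'' at b, a
   DPG step on {aa', bb'} creates a triangle wab with an edge at each vertex.
   Start from four copies of a pair of such trees; work on the first trees of
   the pairs in round 1 and on the second ones in round 2, each time splitting
   the surviving copies into two halves. *)

(** * Minima of sets of naturals *)

Lemma least_eq (P : nat -> Prop) n :
  P n -> (forall m, P m -> n <= m) -> least P = Some n.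
Proof.
move=> Pn nP; rewrite /least; case: pselect => [exP|]; last first.
  by case; exists n; apply/asboolP.
case: ex_minnP => m /asboolP Pm mP; congr Some; apply/eqP.
by rewrite eqn_leq nP // mP //; apply/asboolP.
Qed.

Lemma least_Some (P : nat -> Prop) n : least P = Some n -> P n.
Proof.
rewrite /least; case: pselect => // exP; case: ex_minnP => m /asboolP Pm _.
by case=> <-.
Qed.

(** * Cliques and the lower bound *)

Definition clique (G : graph) (A : {set G}) : Prop :=
  {in A &, forall x y, x != y -> [set x; y] \in edges G}.

Lemma contains_completeP k (G : graph) :
  contains (complete k) G <-> exists2 A : {set G}, k <= #|A| & clique A.
Proof.
split=> [[f f_inj f_edge]|[A leA cliA]].
  exists [set f i | i : 'I_k]; first by rewrite card_imset // card_ord.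
  move=> _ _ /imsetP[i _ ->] /imsetP[j _ ->]; rewrite (inj_eq f_inj) => neq_ij.
  have -> : [set f i; f j] = f @: [set i; j] by rewrite imsetU1 imset_set1.
  by apply: f_edge; rewrite inE cards2 neq_ij.
have f_inj : injective (fun i : 'I_k => enum_val (widen_ord leA i)).
  by move=> i j /enum_val_inj [/val_inj].
exists (fun i : 'I_k => enum_val (widen_ord leA i)) => // e.
rewrite inE => /cards2P[i [j [neq_ij ->]]]; rewrite imsetU1 imset_set1.
by apply: cliA; rewrite ?enum_valP ?(inj_eq f_inj).
Qed.

Lemma part_dpg (G : graph) (m : move G) i : part m i \subset edges (dpg (matching m)).
Proof. by rewrite -part_cover; case: i; rewrite ?subsetUl ?subsetUr. Qed.

(** Every edge created by a DPG step contains [None], so an edge avoiding it comes from [G]. *)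
Lemma next_graph_edge (G : graph) (m : move G) i (x y : G) :
  [set Some x; Some y] \in edges (next_graph m i) -> [set x; y] \in edges G.
Proof.
move/(subsetP (part_dpg m i)) => /setUP[/imsetP[e /setDP[eG _] eq_e]|].
  suff -> : [set x; y] = e by [].
  have Some_injG : injective (@Some G) by move=> ? ? [].
  by apply: (imset_inj Some_injG); rewrite /= imsetU1 imset_set1.
case/imsetP=> v _ /setP/(_ None).
by rewrite !inE.
Qed.

Lemma clique_next (G : graph) (m : move G) i (A : {set next_graph m i}) :
  clique A -> clique [set x : G | Some x \in A].
Proof.
move=> cliA x y; rewrite !inE => xA yA neq_xy.
by apply: (@next_graph_edge _ m i); apply: cliA.
Qed.

Lemma card_preim_Some (T : finType) (A : {set option T}) :
  #|[set x | Some x \in A]| = #|A :\ None|.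
Proof.
have Some_injT : injective (@Some T) by move=> ? ? [].
rewrite -(card_imset _ Some_injT); congr #|pred_of_set _|.
apply/setP=> -[x|]; rewrite !inE ?(mem_imset _ _ Some_injT) ?inE //.
by apply/imsetP=> -[].
Qed.

Section LowerBound.

Variables (G : graph) (m1 : move G) (i1 : bool).
Hypothesis trifree : triangle_free G.
Let G1 := next_graph m1 i1.

Lemma clique_trifree (A : {set G}) : clique A -> #|A| < 3.
Proof.
by move=> cliA; rewrite ltnNge; apply/negP=> ?; apply/trifree/contains_completeP; exists A.
Qed.

(** The vertices other than [None] form a clique of the triangle-free [G], so there are at most
    two. *)
Lemma card_clique_next (A : {set G1}) : clique A -> #|A| < (None \in A) + 3.
Proof.
move/clique_next/clique_trifree; rewrite card_preim_Some => ltA.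
by rewrite (cardsD1 None A) ltn_add2l.
Qed.

(** Here [None] is w2 and [Some None] is w1. Without w2 at most two vertices remain, or three if w1
    is among them. *)
Lemma K4_next2 (m2 : move G1) i2 (A : {set next_graph m2 i2}) :
  3 < #|A| -> clique A -> (None \in A) && (Some None \in A).
Proof.
move=> ltA /clique_next/card_clique_next; rewrite inE card_preim_Some.
move: ltA; rewrite (cardsD1 None A).
by case: (None \in A); case: (Some None \in A) => //=;
  case: #|_| => [|[|[|[|k]]]].
Qed.

Lemma K4_next1 : ~ contains (complete 4) G1.
Proof.
case/contains_completeP=> A ltA /card_clique_next; rewrite ltnNge => /negP[].
by apply: leq_trans ltA; case: (_ \in _).
Qed.

Lemma K4_next2_one (m2 : move G1) :
  exists i, ~ contains (complete 4) (next_graph m2 i).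
Proof.
case: (pselect (contains (complete 4) (next_graph m2 false))); last by exists false.
have w12 i : contains (complete 4) (next_graph m2 i) ->
    [set None; Some None] \in part m2 i.
  case/contains_completeP=> A ltA cliA; case/andP: (K4_next2 ltA cliA) => A0 A1.
  exact: cliA.
move=> /w12 in0; exists true => /w12 in1.
by have /pred0P/(_ [set None; Some None]) := part_disjoint m2; rewrite /= in0 in1.
Qed.

End LowerBound.

Lemma forcing_K4_lower (G : graph) T :
  triangle_free G -> forces_within (complete 4) G T -> 3 <= T.
Proof.
move=> trifree [[m1 s1] win]; rewrite leqNgt; apply/negP=> ltT.
case E: (s1 false) => [m2 s2].
have [i noK4] := K4_next2_one trifree m2.
(* Index 1 is the selection of round 2; in round 1 Chooser selects [false], to which [m2] is the
   reply. *)
have [[|[|[|t]]] leT] := win (fun t => if t is 1 then i else false).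
- move=> /= /contains_completeP[A ltA /(clique_trifree trifree)].
  by rewrite ltnNge ltnW.
- exact: K4_next1.
- by rewrite /= E.
- by have := leq_ltn_trans leT ltT.
Qed.

(** * Strategies of bounded length *)

(** The game tree cut after [T] rounds, an inductive substitute for infinite strategies. *)
Fixpoint wins (H G : graph) (T : nat) : Prop :=
  contains H G \/
  if T is T'.+1 then exists m : move G, forall i, wins H (next_graph m i) T'
  else False.

Lemma is_matching0 (G : graph) : is_matching (G := G) set0.
Proof. by rewrite /is_matching sub0set; apply/trivIsetP=> A B; rewrite inE. Qed.

Section SplitMove.

Variables (G : graph) (M : {set {set G}}) (A : {set {set option G}}).
Hypothesis matchM : is_matching M.

Definition split_part (i : bool) : {set {set dpg M}} :=
  [set e in edges (dpg M) | (e \in A) == i].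

Lemma split_part_cover : split_part false :|: split_part true = edges (dpg M).
Proof. by apply/setP=> e; rewrite !inE; case: (e \in A); rewrite ?andbF ?andbT ?orbF. Qed.

Lemma split_part_disjoint : [disjoint split_part false & split_part true].
Proof.
by apply/pred0P=> e; rewrite /= !inE; case: (e \in A); rewrite ?andbF ?andbT.
Qed.

Definition split_move : move G := Move matchM split_part_cover split_part_disjoint.

End SplitMove.

(** A strategy has to continue even after a win; this one plays the empty matching and puts all
    edges into class [false]. *)
CoFixpoint idle (G : graph) : strategy G :=
  Strategy (fun i => idle (next_graph (split_move set0 (is_matching0 G)) i)).

Lemma wins_forces (H G : graph) T : wins H G T -> forces_within H G T.
Proof.
have stop (K : graph) n : contains H K -> forces_within H K n.
  by move=> HK; exists (idle K) => c; exists 0.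
elim: T G => [|T IH] G [/stop // | //].
case=> m winm; have [s0 win0] := IH _ (winm false).
have [s1 win1] := IH _ (winm true).
exists (Strategy (fun i : bool =>
  match i return strategy (next_graph m i) with true => s1 | false => s0 end)).
move=> c; case c0: (c 0).
  have [t leT Ht] := win1 (fun j => c j.+1).
  by exists t.+1 => //=; rewrite c0.
have [t leT Ht] := win0 (fun j => c j.+1).
by exists t.+1 => //=; rewrite c0.
Qed.

(** * Edge lists *)

(* The game is played on lists of pairs (x, y) with x < y < n, which can be
   computed with; the new vertex of a DPG step is n. *)
Definition ordered n (es : seq (nat * nat)) := all (fun e => e.1 < e.2 < n) es.

Definition endpoints (es : seq (nat * nat)) := flatten [seq [:: e.1; e.2] | e <- es].

Definition dpg_list n (ms es : seq (nat * nat)) :=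
  [seq e <- es | e \notin ms] ++ [seq (x, n) | x <- endpoints ms].

Definition edge_image (V : finType) (f : nat -> V) (e : nat * nat) := [set f e.1; f e.2].

(** Only the listed edges must be present, so further edges of [G] do no harm. *)
Definition embeds (G : graph) n (es : seq (nat * nat)) (f : nat -> G) : Prop :=
  {in gtn n &, injective f} /\ {in es, forall e, edge_image f e \in edges G}.

Definition list_wins (H : graph) n es T : Prop :=
  forall (G : graph) (f : nat -> G), embeds n es f -> wins H G T.

(** Increasing order leaves one way to read a two-element set as a pair. *)
Lemma edge_image_inj (V : finType) n (f : nat -> V) (p q : nat * nat) :
  {in gtn n &, injective f} -> p.1 < p.2 < n -> q.1 < q.2 < n ->
  edge_image f p = edge_image f q -> p = q.
Proof.
case: p q => [a b] [c d] f_inj /= /andP[ltab ltb] /andP[ltcd ltd] eqf.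
have lta := ltn_trans ltab ltb; have ltc := ltn_trans ltcd ltd.
have sub x : x < n -> f x \in edge_image f (c, d) -> x = c \/ x = d.
  by move=> ltx /set2P[] /f_inj->; auto.
have := sub a lta; have := sub b ltb; rewrite -eqf !inE !eqxx orbT /=.
case=> // eb; case=> // ea; subst; rewrite ?ltnn // in ltab *.
by have := ltn_trans ltab ltcd; rewrite ltnn.
Qed.

Lemma mem_endpoints x ms :
  reflect (exists2 e, e \in ms & x = e.1 \/ x = e.2) (x \in endpoints ms).
Proof.
apply: (iffP flatten_mapP) => [[e eP xe]|[e eP exy]]; exists e => //.
  by move: xe; rewrite !inE => /orP[]/eqP; auto.
by rewrite !inE; case: exy => ->; rewrite eqxx ?orbT.
Qed.

Lemma endpoints_disjoint ms p q x : uniq (endpoints ms) -> p \in ms -> q \in ms ->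
  x \in [:: p.1; p.2] -> x \in [:: q.1; q.2] -> p = q.
Proof.
elim: ms => //= e ms IH; rewrite -/(endpoints ms).
rewrite inE negb_or => /and3P[/andP[_ e1] e2 ums].
have no r : r \in ms -> x \in [:: e.1; e.2] -> x \in [:: r.1; r.2] -> False.
  move=> rms xe xr; have xms : x \in endpoints ms by apply/flatten_mapP; exists r.
  by move: xe e1 e2; rewrite !inE => /orP[]/eqP<-; rewrite xms.
move=> /predU1P[->|pms] /predU1P[->|qms] xp xq //.
- by case: (no q).
- by case: (no p).
- exact: IH.
Qed.

(** Builder plays the image of [ms], a matching by [uniq (endpoints ms)], and puts the image of each
    pair [e] into class [c e]. *)
Lemma list_wins_step H n es ms (c : nat * nat -> bool) T :
  ordered n es -> all (mem es) ms -> uniq (endpoints ms) ->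
  (forall i, list_wins H n.+1 [seq e <- dpg_list n ms es | c e == i] T) ->
  list_wins H n es T.+1.
Proof.
move=> /allP ord_es /allP sub_ms uniq_ms win G f [f_inj f_edge].
pose M := [set:: [seq edge_image f e | e <- ms]].
have MP e : reflect (exists2 p, p \in ms & e = edge_image f p) (e \in M).
  by rewrite in_set; apply: mapP.
have edge_lt e : e \in es -> (e.1 < n) * (e.2 < n).
  by move=> /ord_es /andP[lt1 lt2]; split=> //; apply: ltn_trans lt2.
have matchM : is_matching M.
  apply/andP; split; first by apply/subsetP=> _ /MP[p /sub_ms pes ->]; apply: f_edge.
  apply/trivIsetP=> _ _ /MP[p pms ->] /MP[q qms ->]; apply: contraNT.
  case/pred0Pn=> v /andP[/= vp vq]; apply/eqP; congr (edge_image f).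
  have [ltp1 ltp2] := edge_lt _ (sub_ms _ pms).
  have [ltq1 ltq2] := edge_lt _ (sub_ms _ qms).
  have [x xp ev] : exists2 x, x \in [:: p.1; p.2] & v = f x.
    by case/set2P: vp => ->; eexists => //; rewrite !inE eqxx ?orbT.
  apply: (endpoints_disjoint uniq_ms pms qms xp); subst v.
  have ltx : x < n by move: xp; rewrite !inE => /orP[]/eqP->.
  by case/set2P: vq => /f_inj->; rewrite ?inE ?eqxx ?orbT.
(* The embedding extended to the new vertex: [n] goes to [None]. *)
pose f' x := if x < n then Some (f x) else None.
have f'_inj : {in gtn n.+1 &, injective f'}.
  move=> x y; rewrite !unfold_in /= !ltnS /f'.
  case: ltnP => [ltx _|gex lex]; case: ltnP => [lty _|gey ley] //.
    by case=> /f_inj; apply.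
  by move=> _; apply/eqP; rewrite eqn_leq (leq_trans lex gey) (leq_trans ley gex).
have ord_new : ordered n.+1 (dpg_list n ms es).
  apply/allP=> e; rewrite mem_cat mem_filter => /orP[/andP[_ /ord_es]|].
    by case/andP=> -> /= /ltnW.
  case/mapP=> x /mem_endpoints[p /sub_ms/edge_lt[lt1 lt2] ex] -> /=.
  by rewrite ltnS leqnn andbT; case: ex => ->.
have new_edge e : e \in dpg_list n ms es -> edge_image f' e \in edges (dpg M).
  rewrite mem_cat mem_filter => /orP[/andP[ems ees]|].
    have [lt1 lt2] := edge_lt _ ees.
    apply/setUP; left; apply/imsetP; exists (edge_image f e); last first.
      by rewrite /edge_image /f' lt1 lt2 imsetU1 imset_set1.
    rewrite inE f_edge // andbT; apply/MP=> -[p pms] /edge_image_inj eq_ep.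
    have pes := sub_ms _ pms; move: ems; rewrite (eq_ep n) ?pms //; exact: ord_es.
  case/mapP=> x /mem_endpoints[p pms ex] -> /=.
  have [lt1 lt2] := edge_lt _ (sub_ms _ pms).
  have ltx : x < n by case: ex => ->.
  apply/setUP; right; apply/imsetP; exists (f x).
    apply/bigcupP; exists (edge_image f p); first by apply/MP; exists p.
    by case: ex => ->; rewrite !inE eqxx ?orbT.
  by rewrite /edge_image /f' /= ltx ltnn setUC.
pose A := [set:: [seq edge_image f' e | e <- [seq e <- dpg_list n ms es | c e]]].
right; exists (split_move A matchM) => i; apply: (win i (next_graph (split_move A matchM) i) f'); split=> // e.
rewrite mem_filter => /andP[/eqP ci enew].
rewrite inE new_edge //=; apply/eqP; rewrite in_set; apply/mapP/idP => [|it].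
  case=> p; rewrite mem_filter => /andP[cp pnew] /edge_image_inj eq_ep.
  rewrite -ci (eq_ep n.+1) //; exact: (allP ord_new).
by exists e; rewrite // mem_filter ci it.
Qed.

Lemma list_wins_clique n es vs :
  ordered n es -> all (gtn n) vs -> pairwise (fun x y => (x, y) \in es) vs ->
  list_wins (complete (size vs)) n es 0.
Proof.
move=> /allP ord_es /allP ltvs vs_es G f [f_inj f_edge]; left.
have uvs : uniq vs.
  (* Pairs of [es] are increasing, hence so is [vs]. *)
  apply: (pairwise_uniq (r := ltn)); first exact: ltnn.
  by apply: sub_pairwise vs_es => x y /ord_es /andP[].
apply/contains_completeP; exists [set:: map f vs].
  rewrite cardsE (card_uniqP _) ?size_map // map_inj_in_uniq //.
  by move=> x y /ltvs ltx /ltvs lty; apply: f_inj.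
move=> a b; rewrite !in_set => /mapP[x xvs ->{a}] /mapP[y yvs ->{b}].
rewrite -(nth_index 0 xvs) -(nth_index 0 yvs).
move: xvs yvs; rewrite -!index_mem.
move: (index x vs) (index y vs) => i j lti ltj neq_ij.
have nth_edge k l : k < size vs -> l < size vs -> k < l ->
    [set f (nth 0 vs k); f (nth 0 vs l)] \in edges G.
  by move=> ltk ltl /(pairwiseP 0 vs_es k l ltk ltl) /f_edge.
case: (ltngtP i j) => [|/nth_edge h|eq_ij]; first exact: nth_edge.
  by rewrite setUC h.
by rewrite eq_ij eqxx in neq_ij.
Qed.

(** * From an edge list to a graph *)

Section ListGraph.

Variables (n : nat) (es : seq (nat * nat)).
Hypothesis ord_es : ordered n.+1 es.

Definition list_edges : {set {set 'I_n.+1}} :=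
  [set:: [seq edge_image inord e | e <- es]].

Lemma list_edges_card2 e : e \in list_edges -> #|e| = 2.
Proof.
rewrite in_set => /mapP[p /(allP ord_es) /andP[ltp ltpn] ->].
rewrite cards2 -val_eqE /= !inordK ?neq_ltn ?ltp //.
exact: ltn_trans ltpn.
Qed.

Definition list_graph : graph := Graph list_edges_card2.

Lemma list_graph_embeds : embeds (G := list_graph) n.+1 es inord.
Proof.
split=> [x y ltx lty /(congr1 (@nat_of_ord n.+1))|e ees]; first by rewrite !inordK.
by rewrite in_set map_f.
Qed.

(** Two of the three vertices of a triangle would share a colour of [s]. *)
Lemma bipartite_trifree (s : nat -> bool) :
  all (fun e => s e.1 != s e.2) es -> triangle_free list_graph.
Proof.
move=> /allP bip [f f_inj f_edge].
have neq i j : i != j -> s (f i) != s (f j).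
  move=> neq_ij; have : [set f i; f j] \in list_edges.
    have -> : [set f i; f j] = f @: [set i; j] by rewrite imsetU1 imset_set1.
    by apply: f_edge; rewrite inE cards2 neq_ij.
  rewrite in_set => /mapP[p pes eqp].
  have /andP[ltp ltpn] := allP ord_es p pes.
  have lt1 := ltn_trans ltp ltpn; have neqs := bip p pes.
  have neq_f : f i != f j by rewrite (inj_eq f_inj).
  have sE x : x \in [:: p.1; p.2] -> s (inord x : 'I_n.+1) = s x.
    by rewrite !inE => /orP[]/eqP->; rewrite inordK.
  move: neq_f (set21 (f i) (f j)) (set22 (f i) (f j)).
  rewrite eqp => neq_f /set2P[] fi /set2P[] fj; move: neq_f; rewrite fi fj ?eqxx // => _;
    by rewrite !sE ?inE ?eqxx ?orbT // eq_sym.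
pose v k (ltk : k < 3) : complete 3 := Ordinal ltk.
move: (neq (v 0 isT) (v 1 isT) isT) (neq (v 1 isT) (v 2 isT) isT).
move: (neq (v 0 isT) (v 2 isT) isT).
by case: (s _) => //; case: (s _) => //; case: (s _).
Qed.

End ListGraph.

(** * The graph *)

(* Tree number j has vertices 6j, ..., 6j+5 for a, b, a', b', a'', b''. *)
Definition tree j : seq (nat * nat) :=
  let v := addn (6 * j) in
  [:: (v 0, v 1); (v 0, v 2); (v 1, v 3); (v 0, v 4); (v 1, v 5)].

(** The edges aa' and bb'; the step leaves aa'', bb'' and wa' for the matching of round 3. *)
Definition tree_matching j : seq (nat * nat) :=
  let v := addn (6 * j) in [:: (v 0, v 2); (v 1, v 3)].

(** Trees 2k and 2k+1 form one of the four pairs. *)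
Definition forest : seq (nat * nat) := flatten [seq tree j | j <- iota 0 8].

Lemma forest_ordered : ordered 48 forest.
Proof. by []. Qed.

Lemma forest_wins : list_wins (complete 4) 48 forest 3.
Proof.
(* Trees 0 to 3 are separated from trees 4 to 7; an edge goes with its smaller end, which is the old
   end of a new edge. *)
apply: (list_wins_step
  (ms := flatten [seq tree_matching j | j <- [:: 0; 2; 4; 6]])
  (c := fun e => e.1 < 24)) => // x.
(* Trees s to s+3 survive; the next split is between trees s+1 and s+2. *)
pose s := if x then 0 else 4.
apply: (list_wins_step
  (ms := flatten [seq tree_matching j | j <- [:: s.+1; s.+3]])
  (c := fun e => e.1 < 6 * s.+2)) => [|||y].
1-3: by rewrite {}/s; case: x; vm_compute.
(* Trees t and t+1 survive, with triangles through 48 and 49 respectively. *)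
pose t := if y then s else s.+2.
(* The vertices 48 and 49 are those added in rounds 1 and 2. *)
pose v := addn (6 * t); pose u := addn (6 * t.+1).
(* The matching covers both triangles, so vertex 50 completes each to a K_4. Class [true] takes the
   edges whose smaller end is in the first triangle. *)
apply: (list_wins_step
  (ms := [:: (v 0, v 4); (v 1, v 5); (v 2, 48);
             (u 0, u 4); (u 1, u 5); (u 2, 49)])
  (c := fun e => e.1 \in [:: v 0; v 1; 48])) => [|||[]].
1-3: by rewrite {}/v {}/u {}/t {}/s; case: x; case: y; vm_compute.
  apply: (list_wins_clique (vs := [:: v 0; v 1; 48; 50]));
    by rewrite {}/v {}/u {}/t {}/s; case: x; case: y; vm_compute.
apply: (list_wins_clique (vs := [:: u 0; u 1; 49; 50]));
  by rewrite {}/v {}/u {}/t {}/s; case: x; case: y; vm_compute.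
Qed.

Theorem theorem5p6 :
  (exists2 G : graph, triangle_free G & forcing_time (complete 4) G = Some 3)
  /\ rho 4 = Some 3.
Proof.
have ex3 : exists2 G : graph, triangle_free G & forcing_time (complete 4) G = Some 3.
  exists (list_graph forest_ordered).
    (* One colour class consists of a, b' and b'' of every tree. *)
    exact: (bipartite_trifree (s := fun v => v %% 6 \in [:: 0; 3; 5])).
  apply: least_eq => [|T]; last first.
    apply: forcing_K4_lower.
    exact: (bipartite_trifree (s := fun v => v %% 6 \in [:: 0; 3; 5])).
  by apply/wins_forces/forest_wins/list_graph_embeds.
split=> //; apply: least_eq => // T [G trifree /least_Some].
exact: forcing_K4_lower.
Qed.
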